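(* Let $N\ge1$ be an integer and let $q_0,\dots,q_N\ge0$ be real numbers with $\sum_{m=0}^Nq_m=1$ and $q_N>0$. Consider the $N$-round biased-coin game with Forecaster for the distribution $(q_m)_{m=0}^N$, let $S_N=x_1+\dots+x_N$, and let $\eta:\{0,\dots,N\}\to\mathbb R$ be any function. Then the upper and lower expected values of $\eta(S_N)$ coincide and are given by $$\overline{\mathbb E}(\eta(S_N))=\underline{\mathbb E}(\eta(S_N))=\sum_{m=0}^N\eta(m)\,q_m.$$
   Context: Put $\bar q_m=\dfrac{q_m+\dots+q_N}{q_{m-1}+q_m+\dots+q_N}$ for $m=1,\dots,N$. Biased-coin game with Forecaster for the distribution $(q_m)$: an initial capital $\mathcal K_0\in\mathbb R$ is given, and $S_0=0$. In each round $n=1,\dots,N$, Forecaster announces $p_n=\bar q_n$ if $S_{n-1}=n-1$ and $p_n=0$ otherwise; then Skeptic announces $M_n\in\mathbb R$; then Reality announces $x_n\in\{0,1\}$; Skeptic's capital is updated by $\mathcal K_n=\mathcal K_{n-1}+M_n(x_n-p_n)$ and $S_n=S_{n-1}+x_n$. A path is a sequence $\xi=x_1\dots x_N$ of Reality's moves. A strategy $\mathcal P$ of Skeptic specifies each $M_n$ as a function of Reality's previous moves $x_1,\dots,x_{n-1}$. $\mathcal K^{\mathcal P}_n(\xi)$ denotes Skeptic's capital after round $n$ along $\xi$ when he uses $\mathcal P$ with initial capital $0$. For a random variable, i.e. a real-valued function $x(\xi)$ of the path, $$\overline{\mathbb E}x=\inf\{\alpha\in\mathbb R \mid \exists\mathcal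 P\ \forall\xi:\ \mathcal K^{\mathcal P}_N(\xi)\ge x(\xi)-\alpha\},$$ $$\underline{\mathbb E}x=\sup\{\alpha\in\mathbb R \mid \exists\mathcal P\ \forall\xi:\ \mathcal K^{\mathcal P}_N(\xi)\ge \alpha-x(\xi)\}.$$ *)

(* Defs.v *)
From mathcomp Require Import all_boot all_order all_algebra.
From mathcomp Require Import all_classical all_reals ereal.

Set Implicit Arguments.
Unset Strict Implicit.
Unset Printing Implicit Defensive.

Import Order.TTheory GRing.Theory Num.Theory.
Local Open Scope classical_set_scope.
Local Open Scope ring_scope.

(* Forecaster and Skeptic both map the sequence of Reality's previous moves
   x_1 ... x_(n-1) to their move in round n; n is recovered as one plus the
   length of that sequence. [true] stands for x_n = 1. *)
Definition strategy (R : realType) := seq bool -> R.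

Definition score (s : seq bool) (n : nat) : nat :=
  (\sum_(x <- take n s) x)%N.

Lemma score_lt N (xi : N.-tuple bool) : (score xi N < N.+1)%N.
Proof.
rewrite /score ltnS take_oversize ?size_tuple //.
rewrite -[X in (_ <= X)%N](size_tuple xi) -sum1_size.
by apply: leq_sum => -[].
Qed.

Definition final_score N (xi : N.-tuple bool) : 'I_N.+1 :=
  Ordinal (score_lt xi).

(* The ratio only occurs for m = 1, ..., N. *)
Definition qbar (R : realType) N (q : 'I_N.+1 -> R) (m : nat) : R :=
  (\sum_(i < N.+1 | (m <= i)%N) q i) / (\sum_(i < N.+1 | (m.-1 <= i)%N) q i).

Definition forecaster (R : realType) N (q : 'I_N.+1 -> R) : strategy R :=
  fun s => if score s (size s) == size s then qbar q (size s).+1 else 0.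

(* Move x_(n+1) is [nth false xi n], moves being indexed from 0. *)
Fixpoint capital (R : realType) (K0 : R) (p P : strategy R)
    (xi : seq bool) (n : nat) : R :=
  match n with
  | 0%N => K0
  | n'.+1 => capital K0 p P xi n' +
      P (take n' xi) * ((nth false xi n')%:R - p (take n' xi))
  end.

(* The infimum and supremum are taken in the extended reals, so that they
   carry no default value on empty or unbounded sets. *)
Definition upper_expectation (R : realType) N (p : strategy R)
    (x : N.-tuple bool -> R) : \bar R :=
  ereal_inf [set a%:E | a in [set a : R | exists P : strategy R,
    forall xi : N.-tuple bool, capital 0 p P xi N >= x xi - a]].

Definition lower_expectation (R : realType) N (p : strategy R)
    (x : N.-tuple bool -> R) : \bar R :=
  ereal_sup [set a%:E | a in [set a : R | exists P : strategy R,
    forall xi : N.-tuple bool, capital 0 p P xi N >= a - x xi]].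

(* Main.v *)
(** The capital a strategy earns has zero mean when the path [1^m 0^(N-m)] is
    given probability [q m], so neither expectation can beat the [q]-mean of
    [eta].  Conversely, as long as Reality has only played ones, Skeptic holds
    the conditional [q]-mean of [eta] given that the score is at least the
    number of rounds played; the first zero, in round [k.+1], leaves him with
    exactly [eta k].  Afterwards a one costs nothing to bet on, and a stake
    exceeding the oscillation of [eta] covers any later change of the score. *)
Require Import Defs.
From mathcomp Require Import all_boot all_order all_algebra.
From mathcomp Require Import all_classical all_reals ereal.
From mathcomp Require Import ring lra.

Set Implicit Arguments.
Unset Strict Implicit.
Unset Printing Implicit Defensive.

Import Order.TTheory GRing.Theory Num.Theory.
Local Open Scope ring_scope.

Lemma scoreS (s : seq bool) (n : nat) :
  score s n.+1 = (score s n + nth false s n)%N.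
Proof.
rewrite /score; case: (ltnP n (size s)) => ns.
  by rewrite (take_nth false ns) -cats1 big_cat big_seq1.
by rewrite !take_oversize ?nth_default ?addn0 // ltnW.
Qed.

Lemma score_le (s : seq bool) (n : nat) : (score s n <= n)%N.
Proof.
elim: n => [|n IHn]; first by rewrite /score take0 big_nil.
by rewrite scoreS -addn1 leq_add // leq_b1.
Qed.

Lemma score_take (s : seq bool) (n : nat) : score (take n s) n = score s n.
Proof. by rewrite /score take_takel. Qed.

Lemma capitalS (R : realType) (K0 : R) (p P : strategy R) (xi : seq bool) n :
  capital K0 p P xi n.+1 = capital K0 p P xi n +
    P (take n xi) * ((nth false xi n)%:R - p (take n xi)).
Proof. by []. Qed.

Section Tail.
Variables (R : realType) (N : nat).
Implicit Types (f q : 'I_N.+1 -> R).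

(** For [q] this is the probability of a score of at least [n], and [qbar q n.+1] unfolds to
    [tail q n.+1 / tail q n]. *)
Definition tail f (n : nat) : R := \sum_(i < N.+1 | (n <= i)%N) f i.

Lemma tail0 f : tail f 0 = \sum_(i < N.+1) f i.
Proof. exact: eq_bigl. Qed.

Lemma tail_recl f n : (n <= N)%N -> tail f n = f (inord n) + tail f n.+1.
Proof.
move=> nN; have nE : @inord N n = n :> nat by rewrite inordK ?ltnS.
rewrite /tail (bigD1 (inord n)) /= ?nE //; congr (_ + _).
by apply: eq_bigl => i; rewrite ltn_neqAle andbC -val_eqE /= nE eq_sym.
Qed.

Lemma tail_last f : tail f N = f ord_max.
Proof.
rewrite tail_recl // /tail big_pred0 ?addr0; last first.
  by move=> i; rewrite leqNgt ltn_ord.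
by congr f; apply: val_inj; rewrite /= inordK.
Qed.

Lemma tail_gt0 q n : (forall i, 0 <= q i) -> 0 < q ord_max -> (n <= N)%N ->
  0 < tail q n.
Proof.
move=> q_ge0 qN_gt0 nN; rewrite /tail (bigD1 ord_max) //=.
by rewrite ltr_wpDr // sumr_ge0.
Qed.

End Tail.

Section Game.
Variables (R : realType) (N : nat) (q : 'I_N.+1 -> R).
Hypothesis q_ge0 : forall m, 0 <= q m.
Hypothesis q_sum1 : \sum_(m < N.+1) q m = 1.
Hypothesis qN_gt0 : 0 < q ord_max.

Lemma forecaster_take (xi : seq bool) n : (n <= size xi)%N ->
  forecaster q (take n xi) =
    if score xi n == n then tail q n.+1 / tail q n else 0.
Proof. by move=> nxi; rewrite /forecaster size_takel // score_take. Qed.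

Definition ones_zeros (m : nat) : N.-tuple bool := [tuple (i < m)%N | i < N].

Lemma nth_ones_zeros m n : (n < N)%N -> nth false (ones_zeros m) n = (n < m)%N.
Proof.
by move=> nN; rewrite -[n]/(val (Ordinal nN)) -tnth_nth tnth_mktuple.
Qed.

Lemma score_ones_zeros m n : (n <= N)%N -> score (ones_zeros m) n = minn n m.
Proof.
elim: n => [_|n IHn nN]; first by rewrite /score take0 big_nil min0n.
rewrite scoreS (IHn (ltnW nN)) nth_ones_zeros //.
case: (ltnP n m) => nm; first by rewrite addn1 (minn_idPl nm).
by rewrite addn0 (minn_idPr (leqW nm)).
Qed.

Lemma take_ones_zeros m n : (n <= N)%N -> (n <= m)%N ->
  take n (ones_zeros m) = nseq n true.
Proof.
move=> nN nm; apply: (@eq_from_nth _ false).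
  by rewrite size_nseq size_takel ?size_tuple.
move=> i; rewrite size_takel ?size_tuple // => ltin.
by rewrite nth_take // nth_nseq ltin nth_ones_zeros ?(leq_trans ltin).
Qed.

(** The game is fair under [q]: of the mass [tail q n] of paths that start with [n] ones,
    [tail q n.+1] continues with a one, and the forecast is exactly this ratio. *)
Lemma capital_mean0 (P : strategy R) n : (n <= N)%N ->
  \sum_(m < N.+1) q m * capital 0 (forecaster q) P (ones_zeros m) n = 0.
Proof.
elim: n => [_|n IHn nN]; first by rewrite big1 // => m _; rewrite mulr0.
have nN' := ltnW nN.
under eq_bigr do rewrite capitalS mulrDr.
rewrite big_split IHn // [LHS]add0r.
set r := tail q n.+1 / tail q n.
(* Paths with [n <= m] share the prefix of [n] ones, hence the same bet. For [m < n] the move and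
   the forecast are both 0, so the bet there can be replaced by the common one. *)
transitivity (\sum_(m < N.+1) P (nseq n true) *
    ((if (n < m)%N then q m else 0) - r * (if (n <= m)%N then q m else 0))).
  apply: eq_bigr => m _.
  rewrite forecaster_take ?size_tuple // -/r nth_ones_zeros //.
  rewrite score_ones_zeros //.
  case: (leqP n m) => nm.
    rewrite eqxx take_ones_zeros //.
    by case: (n < m)%N => /=; ring.
  by rewrite ltn_eqF // ltnNge ltnW //=; ring.
rewrite -big_distrr big_split /= sumrN -big_distrr -!big_mkcond /=.
rewrite -/(tail q n) -/(tail q n.+1) /r divfK ?subrr ?mulr0 //.
by rewrite gt_eqF // tail_gt0.
Qed.

(** The hedging inequality is averaged over the paths [ones_zeros m] with weights [q m]. *)
Lemma mean_le_superhedge (eta : 'I_N.+1 -> R) (P : strategy R) (a : R) :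
  (forall xi : N.-tuple bool,
     eta (final_score xi) - a <= capital 0 (forecaster q) P xi N) ->
  \sum_(m < N.+1) eta m * q m <= a.
Proof.
move=> hedge; rewrite -subr_le0 -[leRHS](capital_mean0 P (leqnn N)).
have -> : \sum_(m < N.+1) eta m * q m - a = \sum_(m < N.+1) q m * (eta m - a).
  rewrite -[a in LHS]mul1r -q_sum1 mulr_suml -sumrB.
  by apply: eq_bigr => m _; ring.
apply: ler_sum => m _.
apply/ler_wpM2l/(le_trans _ (hedge _)) => //.
suff -> : final_score (ones_zeros m) = m by [].
apply: val_inj => /=; rewrite score_ones_zeros //.
by apply/minn_idPr; rewrite -ltnS.
Qed.

Section Replication.
Variable eta : 'I_N.+1 -> R.

Let weta (i : 'I_N.+1) : R := eta i * q i.

Definition cond_mean (n : nat) : R := tail weta n / tail q n.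

(** A crude bound on the oscillation of [eta]. *)
Definition stake : R := (\sum_(i < N.+1) `|eta i|) *+ 2.

(** While all moves are ones, the bet is the gap between the two target capitals: [cond_mean n.+1]
    after a one, [eta n] after a zero. *)
Definition hedge : strategy R := fun s =>
  if score s (size s) == size s
  then cond_mean (size s).+1 - eta (inord (size s)) else stake.

Lemma eta_le_stake i j : eta i - eta j <= stake.
Proof.
have le_sum k : `|eta k| <= \sum_(i < N.+1) `|eta i|.
  by rewrite (bigD1 k) //= lerDl sumr_ge0.
apply: le_trans (ler_norm _) _; apply: le_trans (ler_normB _ _) _.
by rewrite /stake mulr2n lerD.
Qed.

Lemma stake_ge0 : 0 <= stake.
Proof. by rewrite mulrn_wge0 // sumr_ge0. Qed.

Lemma hedge_take (xi : seq bool) n : (n <= size xi)%N ->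
  hedge (take n xi) =
    if score xi n == n then cond_mean n.+1 - eta (inord n) else stake.
Proof. by move=> nxi; rewrite /hedge size_takel // score_take. Qed.

Lemma cond_mean0 : cond_mean 0 = \sum_(m < N.+1) eta m * q m.
Proof. by rewrite /cond_mean !tail0 q_sum1 divr1. Qed.

Lemma cond_mean_last : cond_mean N = eta ord_max.
Proof. by rewrite /cond_mean !tail_last mulfK // gt_eqF. Qed.

(* [k] is the number of ones before the first zero. *)
Lemma capital_hedge (xi : N.-tuple bool) n : (n <= N)%N ->
  let K := capital 0 (forecaster q) hedge xi n in
  if score xi n == n then K = cond_mean n - cond_mean 0
  else exists2 k : nat, (k <= score xi n)%N &
    K = eta (inord k) - cond_mean 0 + stake * (score xi n - k)%:R.
Proof.
elim: n => [_|n]; first by rewrite /score take0 big_nil /= subrr.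
move=> IHn nN; have nN' := ltnW nN; have /= := IHn nN'.
rewrite hedge_take ?forecaster_take ?size_tuple 1?ltnW // scoreS.
have Tn : tail q n != 0 by rewrite gt_eqF // tail_gt0.
have Tn1 : tail q n.+1 != 0 by rewrite gt_eqF // tail_gt0.
case: eqP => [-> ->|/eqP neq [k lek ->]].
  (* The current capital averages the two targets with the forecast weights, so the bet reaches
     both. The mass [q n] is written as a difference of tails for [field]. *)
  have cmE : cond_mean n = (eta (inord n) * (tail q n - tail q n.+1)
      + cond_mean n.+1 * tail q n.+1) / tail q n.
    rewrite /cond_mean divfK // (tail_recl weta nN').
    by rewrite (tail_recl q nN') addrK.
  case: (nth false xi n); rewrite ?addn1 ?eqxx ?addn0.
    by rewrite cmE /=; field.
  (* The first zero comes after [n] ones, so [k] is [n] and no [stake] has been won yet. *)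
  by rewrite ltn_eqF //; exists n => //; rewrite subnn cmE /=; field.
(* After a zero the score lags behind the round for good, so the forecast stays 0 and each one adds
   a full [stake]. *)
have ltn : (score xi n < n)%N by rewrite ltn_neqAle neq score_le.
have ltb : (score xi n + nth false xi n < n.+1)%N.
  by rewrite ltnS (leq_trans _ ltn) // -addn1 leq_add2l leq_b1.
rewrite ltn_eqF //; exists k; first exact: leq_trans lek (leq_addr _ _).
by rewrite -addnBAC // natrD; ring.
Qed.

Lemma hedge_superhedges (xi : N.-tuple bool) :
  eta (final_score xi) - \sum_(m < N.+1) eta m * q m <=
    capital 0 (forecaster q) hedge xi N.
Proof.
have := capital_hedge xi (leqnn N); rewrite -cond_mean0 /=.
case: eqP => [sN ->|_ [k lek ->]].
  by rewrite cond_mean_last (_ : final_score xi = ord_max) //; apply: val_inj.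
(* If ones followed the first zero, a single [stake] already covers the change of [eta]; otherwise
   the replication is exact. *)
case: (ltnP k (score xi N)) => [ltk|gek].
  have stakeM : stake <= stake * (score xi N - k)%:R.
    by rewrite ler_peMr ?stake_ge0 // ler1n subn_gt0.
  by have := eta_le_stake (final_score xi) (inord k); lra.
have kE : k = score xi N by apply/eqP; rewrite eqn_leq lek.
rewrite kE subnn mulr0 addr0 (_ : inord _ = final_score xi) //.
by apply: val_inj; rewrite /= inordK // score_lt.
Qed.

End Replication.

Lemma upper_expectation_final_score (eta : 'I_N.+1 -> R) :
  upper_expectation (forecaster q)
      (fun xi : N.-tuple bool => eta (final_score xi)) =
    (\sum_(m < N.+1) eta m * q m)%:E.
Proof.
apply/eqP; rewrite eq_le; apply/andP; split.
  apply: ereal_inf_lbound; exists (\sum_(m < N.+1) eta m * q m) => //.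
  by exists (hedge eta) => xi; exact: hedge_superhedges.
apply: le_ereal_inf_tmp => _ [a [P hP] <-]; rewrite lee_fin.
exact: mean_le_superhedge hP.
Qed.

(** Subhedging [eta] at [a] is superhedging [- eta] at [- a], so both bounds come from the earlier
    lemmas applied to [- eta]. *)
Lemma lower_expectation_final_score (eta : 'I_N.+1 -> R) :
  lower_expectation (forecaster q)
      (fun xi : N.-tuple bool => eta (final_score xi)) =
    (\sum_(m < N.+1) eta m * q m)%:E.
Proof.
pose mean (f : 'I_N.+1 -> R) := \sum_(m < N.+1) f m * q m.
have meanN : mean (fun m => - eta m) = - mean eta.
  by rewrite /mean -sumrN; apply: eq_bigr => m _; rewrite mulNr.
apply/eqP; rewrite eq_le; apply/andP; split; last first.
  apply: ereal_sup_ubound; exists (mean eta) => //.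
  exists (hedge (fun m => - eta m)) => xi.
  have := hedge_superhedges (fun m => - eta m) xi.
  by rewrite -/(mean _) meanN; lra.
apply: ge_ereal_sup => _ [a [P hP] <-]; rewrite lee_fin -lerN2 -meanN.
by apply: (@mean_le_superhedge _ P) => xi; rewrite opprK addrC.
Qed.

End Game.

Theorem theorem5p1 (R : realType) (N : nat) (q eta : 'I_N.+1 -> R)
    (hN : (1 <= N)%N)
    (q_ge0 : forall m : 'I_N.+1, 0 <= q m)
    (q_sum1 : \sum_(m < N.+1) q m = 1)
    (qN_gt0 : 0 < q ord_max) :
  upper_expectation (forecaster q)
      (fun xi : N.-tuple bool => eta (final_score xi)) =
    lower_expectation (forecaster q)
      (fun xi : N.-tuple bool => eta (final_score xi)) /\
  lower_expectation (forecaster q)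
      (fun xi : N.-tuple bool => eta (final_score xi)) =
    (\sum_(m < N.+1) eta m * q m)%:E.
Proof.
by rewrite upper_expectation_final_score // lower_expectation_final_score.
Qed.
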